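(* Let $q=p^m$ be a power of a prime $p$, let $G\in\mathbb{F}_q[x]$, let $n,r$ be positive integers such that $d:=(m,r)=(mn,r)$, $p\nmid n$ and $(n,p^d-1)=1$, let $a\in\mathbb{F}_q^*$, and let \[f(x)=ax^{p^r}+x\left(G(T(x))-aT(x)^{p^r-1}\right).\] Assume $f$ is a permutation polynomial over $\mathbb{F}_{q^n}$. Then $\bar f(x):=xG(x)$ is a permutation polynomial over $\mathbb{F}_q$ and $\varphi_y(x):=ax^{p^r}+x(G(y)-ay^{p^r-1})$ induces a permutation of $\ker(T)$ for each $y\in\mathbb{F}_q$. Let $\bar f^{-1}\in\mathbb{F}_q[x]$ denote the compositional inverse of $\bar f$ over $\mathbb{F}_q$ and define \[C(x):=\bar f^{-1}(T(x))^{p^r-1}-a^{-1}G\left(\bar f^{-1}(T(x))\right).\] Then: (i) If $x\in\mathbb{F}_{q^n}$ satisfies $C(x)=0$, then the preimage of $x$ under $f$ is $f^{-1}(x)=(x/a)^{q^n/p^r}$. (ii) Otherwise, if $x\in\mathbb{F}_{q^n}$ satisfies $N_{q|p^d}(C(x))\neq1$, then $N_{q|p^d}(C(x))^n\neq1$ and the preimage of $x$ under $f$ is \[f^{-1}(x)=\frac{N_{q|p^d}(C(x))^n}{1-N_{q|p^d}(C(x))^n}\sum_{i=0}^{\frac{mn}{d}-1}C(x)^{-\frac{p^{(i+1)r}-1}{p^r-1}}\left(a^{-1}x\right)^{p^{ir}}.\] (iii) Otherwise (i.e. $C(x)\neq0$ and $N_{q|p^d}(C(x))=1$), the preimage of $x\in\mathbb{F}_{q^n}$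 under $f$ is \[f^{-1}(x)=n^{-1}\left(\bar f^{-1}(T(x))+\sum_{j=0}^{\frac{m}{d}-1}C(x)^{-\frac{p^{(j+1)r}-1}{p^r-1}}\left(a^{-1}\sum_{k=1}^{n-1}k\,x^{p^{kmr/d}}\right)^{p^{jr}}\right).\]
   Context: $T(x)=T_{q^n|q}(x)=\sum_{i=0}^{n-1}x^{q^i}$ is the trace from $\mathbb{F}_{q^n}$ to $\mathbb{F}_q$, $\ker(T)$ its kernel, and $N_{q|p^d}(x)=x^{(q-1)/(p^d-1)}$ the norm from $\mathbb{F}_q$ to $\mathbb{F}_{p^d}$. Integers $n,k$ are viewed in the prime field $\mathbb{F}_p$ and $n^{-1}$ is the inverse there. *)

(* Defs.v *)
From HB Require Import structures.
From mathcomp Require Import all_boot all_algebra all_field.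

Set Implicit Arguments.
Unset Strict Implicit.
Unset Printing Implicit Defensive.

Import GRing.Theory.
Local Open Scope ring_scope.

Section Polynomials.
Variable F : fieldType.

Definition trace_poly (q n : nat) : {poly F} := \sum_(i < n) 'X^(q ^ i).

Definition f_poly (q n p r : nat) (a : F) (G : {poly F}) : {poly F} :=
  a *: 'X^(p ^ r)
  + 'X * (G \Po trace_poly q n - a *: trace_poly q n ^+ (p ^ r - 1)).

Definition fbar_poly (G : {poly F}) : {poly F} := 'X * G.

Definition phi_poly (p r : nat) (a : F) (G : {poly F}) (y : F) : {poly F} :=
  a *: 'X^(p ^ r) + 'X * (G.[y] - a * y ^+ (p ^ r - 1))%:P.

Definition C_poly (q n p r : nat) (a : F) (G fbarinv : {poly F}) : {poly F} :=
  (fbarinv \Po trace_poly q n) ^+ (p ^ r - 1)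
  - a^-1 *: (G \Po (fbarinv \Po trace_poly q n)).

Definition perm_poly (g : {poly F}) : Prop := bijective (horner g).

(* Equality of polynomial functions on [F], i.e. modulo 'X^#|F| - 'X, so the
   inverse is not required to be reduced. *)
Definition compositional_inverse (g h : {poly F}) : Prop :=
  cancel (horner g) (horner h) /\ cancel (horner h) (horner g).

Definition field_norm (q p d : nat) (x : F) : F :=
  x ^+ ((q - 1) %/ (p ^ d - 1)).

End Polynomials.

Definition lift_poly (F : fieldType) (L : fieldExtType F) (g : {poly F}) :
  {poly L} := map_poly (in_alg L) g.

Definition ker_trace (F : fieldType) (L : fieldExtType F) (q n : nat) :
  {pred L} := [pred x : L | root (lift_poly L (trace_poly F q n)) x].
Arguments ker_trace {F} L q n.

Definition induces_permutation (T : Type) (A : {pred T}) (h : T -> T) : Prop :=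
  [/\ {in A, forall x, h x \in A},
      {in A &, injective h} &
      {in A, forall y, exists2 x, x \in A & h x = y}].

Definition is_the_preimage (T : Type) (h : T -> T) (x z : T) : Prop :=
  forall w, h w = x <-> w = z.

(* z ^ (p ^ N / p ^ r) in a finite field of characteristic p.  When N < r the
   exponent is not an integer, and the power is the unique p ^ (r - N)-th root
   of z (the inverse of an iterated Frobenius automorphism). *)
Definition expr_pquot (F : finFieldType) (L : fieldExtType F) (p N r : nat)
    (z : L) : L :=
  if (r <= N)%N then z ^+ (p ^ N %/ p ^ r)
  else odflt 0 [pick w : finvect_type L | (w : L) ^+ (p ^ (r - N)) == z].

(* Main.v *)
(* Let w = f^-1(x) and y = T(w).  Since a y^(p^r) cancels, T(f(w)) = y G(y), so
   y = fbar^-1(T(x)); bijectivity of f then forces that of fbar on F and, by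
   translating along a fibre of T, that of phi_y on ker T.  Given y, the equation
   f(w) = x becomes w^(p^r) - C w = x / a with C = C(x) in F.  Dividing its
   p^(i r)-th power by C^(1 + p^r + ... + p^(i r)) and summing over i telescopes.
   Over m n / d steps Frobenius returns to the identity on L and the power of C
   collected is N(C)^n, so w is recovered when N(C)^n <> 1.  When N(C) = 1, apply
   m / d steps to u = sum_k k s^k(w) instead, where s is the p^(m r / d)-power map,
   a generator of Gal(L / F): the outcome is s(u) - u = n w - T(w). *)
Require Import Defs.
From HB Require Import structures.
From mathcomp Require Import all_boot all_algebra all_field.

Set Implicit Arguments.
Unset Strict Implicit.
Unset Printing Implicit Defensive.

Import GRing.Theory.
Local Open Scope ring_scope.

(** * Reindexing modulo [M] and exponent arithmetic *)

Lemma reindex_mul_coprime (R : Type) (idx : R) (op : Monoid.com_law idx)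
    (M s : nat) (g : nat -> R) :
  coprime M s -> (forall i, g (i %% M)%N = g i) ->
  \big[op/idx]_(i < M) g (i * s)%N = \big[op/idx]_(i < M) g i.
Proof.
move=> coMs g_mod; case: M coMs g_mod => [|M] coMs g_mod; first by rewrite !big_ord0.
pose h (i : 'I_M.+1) : 'I_M.+1 := inord ((i * s) %% M.+1)%N.
have hE i : h i = (i * s %% M.+1)%N :> nat by rewrite inordK ?ltn_mod.
have h_inj : injective h.
  move=> i j /(congr1 val); rewrite /= !hE => /eqP eq_ij; apply/val_inj => /=.
  wlog le_ji : i j eq_ij / (j <= i)%N.
    by move=> wlg; have [/wlg->//|/ltnW/wlg->//] := leqP j i; rewrite eq_sym.
  move: eq_ij; rewrite eqn_mod_dvd ?leq_mul2r ?le_ji ?orbT // -mulnBl.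
  rewrite Gauss_dvdl // => dvd_ij; apply/eqP; rewrite eqn_leq le_ji andbT -subn_eq0.
  by rewrite -[(i - j)%N](@modn_small _ M.+1) ?(leq_ltn_trans (leq_subr _ _)).
rewrite [RHS](reindex_inj h_inj) /=; apply: eq_bigr => i _.
by rewrite hE g_mod.
Qed.

Lemma divn_geometric (b k : nat) :
  (1 < b)%N -> ((b ^ k - 1) %/ (b - 1) = \sum_(j < k) b ^ j)%N.
Proof. by move=> b_gt1; rewrite !subn1 predn_exp mulKn // -subn1 subn_gt0. Qed.

Lemma eval_lift_poly_alg (F : fieldType) (L : fieldExtType F) (g : {poly F})
    (t : F) : (lift_poly L g).[t%:A] = g.[t]%:A.
Proof. exact: (horner_map (in_alg L)). Qed.

Lemma coprime_div_gcd (m r : nat) :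
  (0 < m)%N -> coprime (m %/ gcdn m r) (r %/ gcdn m r).
Proof.
move=> m_gt0; have g_gt0 : (0 < gcdn m r)%N by rewrite gcdn_gt0 m_gt0.
by rewrite /coprime -(eqn_pmul2r g_gt0) mul1n muln_gcdl !divnK ?dvdn_gcdl ?dvdn_gcdr.
Qed.

(** * Frobenius powers, telescoping and the norm exponent *)

Section FrobeniusPowers.
Variables (p : nat) (R : fieldType).
Hypothesis p_char : p \in [pchar R].

Lemma exprD_pchar_pow (k : nat) (x y : R) :
  (x + y) ^+ (p ^ k) = x ^+ (p ^ k) + y ^+ (p ^ k).
Proof. by rewrite exprDn_pchar // pnatX pnatE ?(pcharf_prime p_char) // p_char. Qed.

Lemma pchar_pow_gt0 (k : nat) : (0 < p ^ k)%N.
Proof. by rewrite expn_gt0 (prime_gt0 (pcharf_prime p_char)). Qed.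

Lemma exprB_pchar_pow (k : nat) (x y : R) :
  (x - y) ^+ (p ^ k) = x ^+ (p ^ k) - y ^+ (p ^ k).
Proof.
by apply/eqP; rewrite eq_sym subr_eq -exprD_pchar_pow subrK.
Qed.

Lemma expr_sum_pchar_pow (k : nat) (I : Type) (s : seq I) (P : pred I)
    (f : I -> R) :
  (\sum_(i <- s | P i) f i) ^+ (p ^ k) = \sum_(i <- s | P i) f i ^+ (p ^ k).
Proof.
apply: (big_morph (fun x => x ^+ (p ^ k))); first exact: exprD_pchar_pow.
by rewrite expr0n gtn_eqF ?pchar_pow_gt0.
Qed.

Lemma natr_pchar_pow (k i : nat) : i%:R ^+ (p ^ k) = i%:R :> R.
Proof.
elim: i => [|i IHi]; first by rewrite expr0n gtn_eqF ?pchar_pow_gt0.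
by rewrite -[in LHS]natr1 exprD_pchar_pow IHi expr1n natr1.
Qed.

Lemma pchar_pow_inj (k : nat) : injective (fun x : R => x ^+ (p ^ k)).
Proof.
move=> x y /eqP; rewrite -subr_eq0 -exprB_pchar_pow expf_eq0 subr_eq0.
by case/andP=> _ /eqP.
Qed.

Lemma expr_pow_period (N i k : nat) (x : R) :
  x ^+ (p ^ N) = x -> x ^+ (p ^ (k * N + i)) = x ^+ (p ^ i).
Proof.
move=> xN; elim: k => [|k IHk] //.
by rewrite mulSn -addnA expnD exprM xN.
Qed.

Lemma twisted_telescope (r M : nat) (C w b : R) :
  (0 < r)%N -> C != 0 -> w ^+ (p ^ r) - C * w = b ->
  \sum_(0 <= i < M)
    C ^- ((p ^ (i.+1 * r) - 1) %/ (p ^ r - 1)) * b ^+ (p ^ (i * r))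
  = C ^- (\sum_(j < M) p ^ (j * r))%N * w ^+ (p ^ (M * r)) - w.
Proof.
move=> r_gt0 C_neq0 <-; have p_gt1 := prime_gt1 (pcharf_prime p_char).
have geomE k : ((p ^ (k * r) - 1) %/ (p ^ r - 1) = \sum_(j < k) p ^ (j * r))%N.
  rewrite mulnC expnM divn_geometric; last first.
    by rewrite -(exp1n r) ltn_exp2r.
  by apply: eq_bigr => j _; rewrite -expnM mulnC.
pose f k := C ^- (\sum_(j < k) p ^ (j * r))%N * w ^+ (p ^ (k * r)).
rewrite (@telescope_sumr_eq _ _ _ f) // => [|i _].
  by rewrite /f big_ord0 mul0n expn0 expr0 expr1 invr1 mul1r.
(* The last summand of the geometric exponent is [p ^ (i * r)], so it cancels the factor
   [C ^+ (p ^ (i * r))] in front of [w] and leaves [f i.+1 - f i]. *)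
rewrite geomE exprB_pchar_pow exprMn mulrBr /f -exprM -expnD -mulSn.
by rewrite big_ord_recr /= exprD invfM mulrA mulfVK ?expf_neq0.
Qed.

Section Norm.
Variables (m r d : nat) (c : R).
Hypotheses (m_gt0 : (0 < m)%N) (d_def : d = gcdn m r) (cm : c ^+ (p ^ m) = c).

Let d_gt0 : (0 < d)%N. Proof. by rewrite d_def gcdn_gt0 m_gt0. Qed.
Let d_dvd_m : (d %| m)%N. Proof. by rewrite d_def dvdn_gcdl. Qed.
Let d_dvd_r : (d %| r)%N. Proof. by rewrite d_def dvdn_gcdr. Qed.

(** As [m %/ d] and [r %/ d] are coprime, the exponents [j * r] with [j < m %/ d] run modulo [m]
    through all multiples of [d]. Since [c] is fixed by the [p ^ m]-power, this one turn yields the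
    norm, and every further turn repeats it. *)
Lemma expr_geometric_norm (n : nat) :
  c ^+ (\sum_(j < n * (m %/ d)) p ^ (j * r))%N
  = (c ^+ ((p ^ m - 1) %/ (p ^ d - 1))) ^+ n.
Proof.
have p_gt1 := prime_gt1 (pcharf_prime p_char).
have pd_gt1 : (1 < p ^ d)%N by rewrite -(exp1n d) ltn_exp2r.
have one_turn : c ^+ (\sum_(j < m %/ d) p ^ (j * r))%N
    = c ^+ ((p ^ m - 1) %/ (p ^ d - 1)).
  rewrite -[in RHS](divnK d_dvd_m) mulnC expnM divn_geometric // -!prodrXr.
  under eq_bigr => j _ do rewrite -[in (j * r)%N](divnK d_dvd_r) mulnA.
  rewrite (@reindex_mul_coprime _ _ _ _ _ (fun i => c ^+ (p ^ (i * d)))).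
  - by apply: eq_bigr => j _; rewrite -expnM mulnC.
  - by rewrite d_def coprime_div_gcd.
  - move=> i; rewrite [in RHS](divn_eq i (m %/ d)) mulnDl -mulnA divnK //.
    by rewrite expr_pow_period.
elim: n => [|n IHn]; first by rewrite mul0n big_ord0.
rewrite mulSn addnC big_split_ord /= exprD IHn exprSr; congr (_ * _).
rewrite -one_turn -!prodrXr; apply: eq_bigr => j _.
(* The last turn differs from the first by a multiple of [m] in each exponent. *)
have ->: ((n * (m %/ d) + j) * r = n * (r %/ d) * m + j * r)%N.
  rewrite mulnDl -!mulnA; congr (_ * _ + _)%N.
  by rewrite [LHS]divn_mulAC // [RHS]divn_mulAC // mulnC.
by rewrite expr_pow_period.
Qed.
End Norm.
End FrobeniusPowers.

(** Summation by parts, to be applied to the successive conjugates of [w]. *)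
Lemma sum_mulrn_diff (V : zmodType) (g : nat -> V) (n : nat) :
  \sum_(0 <= k < n) (g k.+1 - g k) *+ k = g n *+ n - \sum_(0 <= k < n) g k.+1.
Proof.
elim: n => [|n IHn]; first by rewrite !big_geq // mulr0n subrr.
rewrite !big_nat_recr //= IHn mulrnBl mulrSr [LHS]addrC addrA subrK.
by rewrite opprD [- _ - _]addrC [RHS]addrA addrK.
Qed.

(** * The trace from [L] to [F] *)

Section TraceAndPermutation.
Variables (p m n : nat) (F : finFieldType) (L : fieldExtType F).
Hypotheses (p_prime : prime p) (card_F : #|F| = (p ^ m)%N).
Hypotheses (dim_L : \dim {:L} = n) (p_ndiv_n : ~~ (p %| n)%N).

Local Notation q := (p ^ m)%N.
Local Notation T x := ((lift_poly L (trace_poly F q n)).[x]).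

Lemma ext_pchar : p \in [pchar L].
Proof. by rewrite pchar_lalg (card_finPcharP card_F). Qed.

Lemma ext_expr_card (x : L) : x ^+ (p ^ (m * n)) = x.
Proof.
have := memvf x; rewrite Fermat's_little_theorem dim_L card_F -expnM.
by move/eqP.
Qed.

Lemma base_expr_card (t : F) : (t%:A : L) ^+ q = t%:A.
Proof. by rewrite -[LHS](rmorphXn (in_alg L)) /= -card_F expf_card. Qed.

Lemma mem_baseP (x : L) : x ^+ q = x -> exists t : F, x = t%:A.
Proof.
move=> xq; apply/vlineP.
by rewrite (Fermat's_little_theorem (1%AS)) dimv1 expn1 card_F xq.
Qed.

Lemma trace_polyE (x : L) : T x = \sum_(i < n) x ^+ (p ^ (i * m)).
Proof.
rewrite /lift_poly /trace_poly rmorph_sum horner_sum; apply: eq_bigr => i _.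
by rewrite /= map_polyXn hornerXn -expnM mulnC.
Qed.

Lemma traceD (x y : L) : T (x + y) = T x + T y.
Proof.
rewrite !trace_polyE -big_split; apply: eq_bigr => i _.
by rewrite (exprD_pchar_pow ext_pchar).
Qed.

Lemma trace_base_mul (t : F) (x : L) : T (t%:A * x) = t%:A * T x.
Proof.
rewrite !trace_polyE mulr_sumr; apply: eq_bigr => i _.
rewrite exprMn; congr (_ * _).
by have := expr_pow_period 0 i (base_expr_card t); rewrite addn0.
Qed.

Lemma traceB (x y : L) : T (x - y) = T x - T y.
Proof.
by rewrite traceD; congr (_ + _); have := trace_base_mul (- 1) y;
   rewrite scaleN1r !mulN1r.
Qed.

Lemma trace_expr (k : nat) (x : L) : T (x ^+ (p ^ k)) = T x ^+ (p ^ k).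
Proof.
rewrite !trace_polyE (expr_sum_pchar_pow ext_pchar).
by apply: eq_bigr => i _; rewrite -!exprM mulnC.
Qed.

(** For [s] prime to [n], the s-th iterate of the [q]-power map still generates the Galois group, so
    the same conjugates are summed in another order. *)
Lemma trace_cycle (s : nat) (x : L) :
  coprime n s -> T x = \sum_(i < n) x ^+ (p ^ (i * (m * s))).
Proof.
move=> co_ns; rewrite trace_polyE.
rewrite -(@reindex_mul_coprime _ _ _ _ s (fun i => x ^+ (p ^ (i * m)))) //.
  by apply: eq_bigr => i _; rewrite -mulnA [(s * m)%N]mulnC.
move=> i; rewrite [in RHS](divn_eq i n) mulnDl -mulnA [(n * m)%N]mulnC.
by rewrite expr_pow_period ?ext_expr_card.
Qed.

Lemma trace_in_base (x : L) : exists t : F, T x = t%:A.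
Proof.
apply: mem_baseP; rewrite -trace_expr !trace_polyE.
case: n (ext_expr_card x) p_ndiv_n => [|n'] xK ndiv; first by rewrite dvdn0 in ndiv.
(* The [q]-power shifts the conjugates cyclically: the last one returns to [x]. *)
rewrite big_ord_recr big_ord_recl /= addrC; congr (_ + _).
  by rewrite -exprM -expnD -mulSn mulnC xK expn0 expr1.
by apply: eq_bigr => i _; rewrite -exprM -expnD -mulSn.
Qed.

Lemma trace_surj (t : F) : exists x : L, T x = t%:A.
Proof.
have n_neq0 : n%:R != 0 :> F.
  by rewrite -(dvdn_pcharf (card_finPcharP card_F p_prime)).
(* The trace multiplies scalars of [F] by [n], which is invertible as [p] does not divide it. *)
exists (t / n%:R)%:A; rewrite trace_polyE (eq_bigr (fun=> (t / n%:R)%:A)).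
  by rewrite sumr_const card_ord scalerMnl -mulr_natr divfK.
move=> i _; by have := expr_pow_period 0 i (base_expr_card (t / n%:R)); rewrite addn0.
Qed.

(** * The map f on the fibres of the trace *)

Variables (r : nat) (a : F) (G : {poly F}).
Hypothesis a_neq0 : a != 0.

Local Notation f x := ((lift_poly L (f_poly q n p r a G)).[x]).
Local Notation fbar t := ((fbar_poly G).[t]).
Local Notation phi y x := ((lift_poly L (phi_poly p r a G y)).[x]).

Lemma phi_polyE (y : F) (x : L) :
  phi y x = a%:A * x ^+ (p ^ r) + (G.[y] - a * y ^+ (p ^ r - 1))%:A * x.
Proof.
rewrite /lift_poly /phi_poly rmorphD /= rmorphM /= map_polyZ /= map_polyXn.
rewrite map_polyX map_polyC !hornerE; congr (_ + _); exact: mulrC.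
Qed.

(** On a fibre of T the coefficient of [x] is constant, so f agrees there with an additive map that
    commutes with T. *)
Lemma f_polyE (x : L) (y : F) : T x = y%:A -> f x = phi y x.
Proof.
move=> Tx; rewrite phi_polyE /lift_poly /f_poly rmorphD /= map_polyZ /=.
rewrite map_polyXn rmorphM /= map_polyX rmorphB /= map_polyZ map_comp_poly rmorphXn /=.
rewrite !(hornerE, horner_comp, horner_exp) -!/(lift_poly L _) Tx.
rewrite eval_lift_poly_alg -(rmorphXn (in_alg L)) -(rmorphM (in_alg L)).
by rewrite -(rmorphB (in_alg L)) [x * _]mulrC.
Qed.

Lemma phiD (y : F) (x z : L) : phi y (x + z) = phi y x + phi y z.
Proof. by rewrite !phi_polyE (exprD_pchar_pow ext_pchar) !mulrDr addrACA. Qed.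

Lemma phiB (y : F) (x z : L) : phi y (x - z) = phi y x - phi y z.
Proof. by apply/eqP; rewrite eq_sym subr_eq -phiD subrK. Qed.

Lemma trace_phi (y : F) (x : L) : T (phi y x) = phi y (T x).
Proof. by rewrite !phi_polyE traceD !trace_base_mul trace_expr. Qed.

Lemma phi_diag (y : F) : phi y (y%:A) = (fbar y)%:A.
Proof.
rewrite phi_polyE -(rmorphXn (in_alg L)) -!(rmorphM (in_alg L)) -(rmorphD (in_alg L)).
rewrite /= /fbar_poly !hornerE mulrBl -mulrA -exprSr subn1 prednK ?expn_gt0 ?prime_gt0 //.
by rewrite addrC subrK mulrC.
Qed.

Lemma trace_f (x : L) (y : F) : T x = y%:A -> T (f x) = (fbar y)%:A.
Proof. by move=> Tx; rewrite (f_polyE Tx) trace_phi Tx phi_diag. Qed.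

Section Permutation.
Hypothesis f_perm : perm_poly (lift_poly L (f_poly q n p r a G)).

Lemma fbar_perm : perm_poly (fbar_poly G).
Proof.
have [finv finvK fK] := f_perm.
(* Lift [t] to some [x] of trace [t]; the trace of the preimage of [x] under f is then sent to
   [t]. *)
have surj t : exists s, fbar s == t.
  have [x Tx] := trace_surj t; have [s Ts] := trace_in_base (finv x).
  by exists s; apply/eqP/(fmorph_inj (in_alg L)); rewrite /= -(trace_f Ts) fK.
have gK : cancel (fun t => xchoose (surj t)) (horner (fbar_poly G)).
  by move=> t; apply/eqP/(xchooseP (surj t)).
(* A right inverse is also a left inverse because [F] is finite. *)
exact: Bijective (canF_sym gK) gK.
Qed.

Lemma ker_traceE (x : L) : (x \in ker_trace L q n) = (T x == 0).
Proof. by []. Qed.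

Lemma phi_perm_ker (y : F) :
  induces_permutation (ker_trace L q n) (horner (lift_poly L (phi_poly p r a G y))).
Proof.
have [v Tv] := trace_surj y; have [finv finvK fK] := f_perm.
have f_shift z : z \in ker_trace L q n -> f (v + z) = f v + phi y z.
  rewrite ker_traceE => /eqP Tz.
  by rewrite !(@f_polyE _ y) ?phiD // traceD Tz addr0.
have phi0 : phi y 0 = 0 by rewrite -(subrr 0) phiB !subrr.
split=> [x||z].
- by rewrite !ker_traceE trace_phi => /eqP->; rewrite phi0.
- move=> x z xK zK eq_xz; apply: (addrI v); apply: (bij_inj f_perm).
  by rewrite !f_shift // eq_xz.
- rewrite ker_traceE => /eqP Tz; have [s Ts] := trace_in_base (finv (f v + z)).
  (* The preimage of [f v + z] stays in the fibre of [v]: both have traces with the same image under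
     fbar, which is injective. *)
  have sy : s = y.
    apply: (bij_inj fbar_perm); apply: (fmorph_inj (in_alg L)) => /=.
    by rewrite -(trace_f Ts) fK traceD Tz addr0 (trace_f Tv).
  rewrite sy in Ts; exists (finv (f v + z) - v).
    by rewrite ker_traceE traceB Ts Tv subrr.
  by rewrite phiB -!f_polyE // fK addrC addKr.
Qed.
End Permutation.

Lemma C_polyE (h : {poly F}) (x : L) (t : F) :
  T x = t%:A -> (lift_poly L (C_poly q n p r a G h)).[x]
    = (h.[t] ^+ (p ^ r - 1) - a^-1 * G.[h.[t]])%:A.
Proof.
move=> Tx; rewrite /lift_poly /C_poly rmorphB /= map_polyZ rmorphXn /=.
rewrite !map_comp_poly !(hornerE, horner_comp, horner_exp) -!/(lift_poly L _) Tx.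
by rewrite !eval_lift_poly_alg -(rmorphXn (in_alg L)) mulr_algl scalerA -scalerBl.
Qed.

Lemma f_C_polyE (h : {poly F}) (w : L) :
  compositional_inverse (fbar_poly G) h ->
  (lift_poly L h).[T (f w)] = T w /\
  w ^+ (p ^ r) - (lift_poly L (C_poly q n p r a G h)).[f w] * w = a^-1 *: f w.
Proof.
case=> hK _; have [y Tw] := trace_in_base w.
rewrite (C_polyE _ (trace_f Tw)) (trace_f Tw) eval_lift_poly_alg hK Tw; split=> //.
rewrite (f_polyE Tw) phi_polyE scalerDr !mulr_algl !scalerA mulVf // scale1r.
by congr (_ + _); rewrite -scaleNr opprB mulrBr [in RHS]mulrA mulVf // mul1r.
Qed.

End TraceAndPermutation.

(** A preimage exists by surjectivity, so it suffices to solve for it; the explicit formulas never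
    have to be substituted back into f. *)
Lemma bij_is_the_preimage (T : Type) (h : T -> T) (x z : T) :
  bijective h -> (forall w, h w = x -> w = z) -> is_the_preimage h x z.
Proof.
case=> g hK gK uniq_z w; split=> [/uniq_z // | ->].
by rewrite -(uniq_z (g x)) gK.
Qed.

Lemma expr_pquotE (p m r : nat) (F : finFieldType) (L : fieldExtType F) (w : L) :
  prime p -> p \in [pchar L] -> w ^+ (p ^ m) = w ->
  expr_pquot p m r (w ^+ (p ^ r)) = w.
Proof.
move=> p_prime p_char wm; rewrite /expr_pquot; case: ifP => [le_rm|/negbT].
  by rewrite -expnB ?prime_gt0 // -exprM -expnD subnKC.
rewrite -ltnNge => /ltnW le_mr.
have root_w : w ^+ (p ^ (r - m)) = w ^+ (p ^ r).
  by rewrite -{2}(subnKC le_mr) expnD exprM wm.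
(* [w] is itself a root, so the default 0 is never returned; injectivity of Frobenius identifies the
   chosen root with [w]. *)
case: pickP => [v /eqP v_root | /(_ w)]; last by rewrite root_w eqxx.
by apply: (pchar_pow_inj p_char (k := r - m)); rewrite root_w v_root.
Qed.

(** * Solving the twisted equation for [w] *)

Section Resolvent.
Variables (p m n r d : nat) (F : finFieldType) (L : fieldExtType F).
Hypotheses (p_prime : prime p) (card_F : #|F| = (p ^ m)%N).
Hypotheses (dim_L : \dim {:L} = n) (m_gt0 : (0 < m)%N) (n_gt0 : (0 < n)%N).
Hypotheses (r_gt0 : (0 < r)%N).
Hypotheses (d_def : d = gcdn m r) (d_def' : d = gcdn (m * n) r).
Variables (c : F) (w b : L).
Hypotheses (c_neq0 : c%:A != 0 :> L) (w_eq : w ^+ (p ^ r) - c%:A * w = b).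

Local Notation N := (field_norm (p ^ m) p d (c%:A : L)).

Let p_char : p \in [pchar L]. Proof. exact: ext_pchar card_F. Qed.
Let cm : (c%:A : L) ^+ (p ^ m) = c%:A. Proof. exact: base_expr_card. Qed.
Let d_dvd_m : (d %| m)%N. Proof. by rewrite d_def dvdn_gcdl. Qed.
Let d_dvd_r : (d %| r)%N. Proof. by rewrite d_def dvdn_gcdr. Qed.

Lemma resolvent_full :
  \sum_(0 <= i < (m * n) %/ d)
     c%:A ^- ((p ^ (i.+1 * r) - 1) %/ (p ^ r - 1)) * b ^+ (p ^ (i * r))
  = (N ^- n - 1) * w.
Proof.
rewrite (twisted_telescope p_char _ r_gt0 c_neq0 w_eq) mulrBl mul1r.
have -> : (m * n %/ d = n * (m %/ d))%N by rewrite mulnC muln_divA.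
rewrite (expr_geometric_norm p_char m_gt0 d_def cm).
(* The total Frobenius exponent is a multiple of [m * n], hence acts trivially on [w]. *)
have -> : (n * (m %/ d) * r = r %/ d * (m * n) + 0)%N.
  by rewrite addn0 [(m * n)%N]mulnC mulnCA -mulnA divn_mulAC // divn_mulAC // [(m * r)%N]mulnC.
by rewrite expr_pow_period ?expr1 ?(ext_expr_card card_F dim_L).
Qed.

Lemma resolvent_norm1 : N = 1 ->
  \sum_(0 <= j < m %/ d)
     c%:A ^- ((p ^ (j.+1 * r) - 1) %/ (p ^ r - 1))
     * (\sum_(1 <= k < n) k%:R * b ^+ (p ^ ((k * m * r) %/ d))) ^+ (p ^ (j * r))
  = n%:R * w - (lift_poly L (trace_poly F (p ^ m) n)).[w].
Proof.
move=> N1; pose g k := w ^+ (p ^ (k * (m * (r %/ d)))).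
have mrdE k : ((k * m * r) %/ d = k * (m * (r %/ d)))%N.
  by rewrite -muln_divA // -mulnA.
pose u := \sum_(1 <= k < n) k%:R * g k.
(* [u] solves the twisted equation for the weighted sum of conjugates of [b]: the weights lie in the
   prime field and [c] is fixed by each conjugation, whose exponent is a multiple of [m]. *)
rewrite (@twisted_telescope _ _ p_char r _ _ u) //; last first.
  rewrite (expr_sum_pchar_pow p_char) mulr_sumr -sumrB; apply: eq_bigr => k _.
  rewrite mrdE exprMn (natr_pchar_pow p_char) mulrCA -mulrBr -w_eq.
  rewrite (exprB_pchar_pow p_char) exprMn /g -!exprM [(_ * p ^ r)%N]mulnC; congr (_ * (_ - _ * _)).
  by rewrite mulnA -[(_ * m * _)%N]addn0 mulnAC expr_pow_period // expr1.
have := expr_geometric_norm p_char m_gt0 d_def cm 1; rewrite mul1n.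
rewrite -/(field_norm (p ^ m) p d (c%:A : L)) N1 => ->; rewrite expr1n invr1 mul1r.
have -> : (m %/ d * r = m * (r %/ d))%N by rewrite divn_mulAC // muln_divA.
have gS k : g k ^+ (p ^ (m * (r %/ d))) = g k.+1.
  by rewrite /g -exprM -expnD mulSnr.
rewrite (expr_sum_pchar_pow p_char) -sumrB.
under eq_bigr => k _ do
  rewrite exprMn (natr_pchar_pow p_char) gS -mulrBr mulr_natl.
have g_n : g n = w.
  rewrite /g mulnA [(n * m)%N]mulnC mulnC -[(_ * _)%N]addn0.
  by rewrite expr_pow_period ?expr1 ?(ext_expr_card card_F dim_L).
have sumE := sum_mulrn_diff g n.
(* The term of index 0 has weight 0, which matches the sum starting at 1. *)
rewrite [X in X = _]big_ltn // mulr0n add0r in sumE; rewrite sumE.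
rewrite g_n mulr_natl; congr (_ - _).
rewrite (trace_cycle card_F dim_L (s := r %/ d)); last first.
  (* Here [d = gcdn (m * n) r] enters: [n] divides [m * n %/ d], which is prime to [r %/ d]. *)
  apply: (@coprime_dvdl _ (m * n %/ d)); last by rewrite d_def' coprime_div_gcd ?muln_gt0 ?m_gt0.
  by rewrite mulnC -muln_divA // dvdn_mulr.
(* The two sums range over shifted indices and agree because [g n] and [g 0] both equal [w]. *)
rewrite -(big_mkord xpredT g) -(prednK n_gt0) big_nat_recr // big_nat_recl //=.
by rewrite addrC prednK // g_n /g mul0n expr1.
Qed.
End Resolvent.

(** * The permutation statements and the three preimage formulas *)

Theorem theorem4p2 (p m q n r d : nat) (F : finFieldType) (L : fieldExtType F)
  (G : {poly F}) (a : F)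
  (p_prime : prime p) (q_def : q = (p ^ m)%N) (card_F : #|F| = q)
  (dim_L : \dim {:L} = n) (n_gt0 : (0 < n)%N) (r_gt0 : (0 < r)%N)
  (d_def : d = gcdn m r) (d_def' : d = gcdn (m * n) r)
  (p_ndiv_n : ~~ (p %| n)%N) (coprime_n : coprime n (p ^ d - 1))
  (a_neq0 : a != 0)
  (f_perm : perm_poly (lift_poly L (f_poly q n p r a G))) :
  [/\ perm_poly (fbar_poly G),
      forall y : F,
        induces_permutation (ker_trace L q n)
          (horner (lift_poly L (phi_poly p r a G y))) &
      forall fbarinv : {poly F},
        compositional_inverse (fbar_poly G) fbarinv ->
        forall x : L,
        let f := horner (lift_poly L (f_poly q n p r a G)) in
        let T := horner (lift_poly L (trace_poly F q n)) in
        let C := horner (lift_poly L (C_poly q n p r a G fbarinv)) in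
        let N := field_norm q p d in
        [/\ C x = 0 ->
              is_the_preimage f x (expr_pquot p (m * n) r (a^-1 *: x)),
            C x != 0 -> N (C x) != 1 ->
              N (C x) ^+ n != 1 /\
              is_the_preimage f x
                (N (C x) ^+ n / (1 - N (C x) ^+ n)
                 * \sum_(0 <= i < (m * n) %/ d)
                     C x ^- ((p ^ (i.+1 * r) - 1) %/ (p ^ r - 1))
                     * (a^-1 *: x) ^+ (p ^ (i * r))) &
            C x != 0 -> N (C x) = 1 ->
              is_the_preimage f x
                (n%:R^-1
                 * ((lift_poly L fbarinv).[T x]
                    + \sum_(0 <= j < m %/ d)
                        C x ^- ((p ^ (j.+1 * r) - 1) %/ (p ^ r - 1))
                        * (a^-1 *: \sum_(1 <= k < n)
                             k%:R * x ^+ (p ^ ((k * m * r) %/ d)))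
                          ^+ (p ^ (j * r))))]].
Proof.
subst q; have p_char : p \in [pchar L] by exact: ext_pchar card_F.
have m_gt0 : (0 < m)%N.
  rewrite lt0n; apply: contraTneq (finNzRing_gt1 F) => m0.
  by rewrite card_F m0.
have d_dvd_m : (d %| m)%N by rewrite d_def dvdn_gcdl.
split; first exact: fbar_perm f_perm.
  by move=> y; apply: phi_perm_ker f_perm _.
move=> fbarinv inv_fbar x f T C N.
have [s Ts] := trace_in_base p_prime card_F dim_L p_ndiv_n x.
have [c CE] : exists c : F, C x = c%:A by eexists; exact: C_polyE Ts.
have preim w : f w = x ->
    (lift_poly L fbarinv).[T x] = T w /\ w ^+ (p ^ r) - c%:A * w = a^-1 *: x.
  move=> fw; rewrite -CE -fw; exact: f_C_polyE.
rewrite CE; split=> [c0|c_neq0 N_neq1|c_neq0 N1].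
- apply: bij_is_the_preimage => // w /preim[_]; rewrite c0 mul0r subr0 => <-.
  by rewrite expr_pquotE // (ext_expr_card card_F dim_L).
- have N_n : N c%:A ^+ n != 1.
    apply: contra N_neq1 => /eqP Nn1.
    (* This power of the norm is c^(q-1), which is 1 since [c] is a nonzero element of [F]. *)
    have Npd : N c%:A ^+ (p ^ d - 1) = 1.
      rewrite /N /field_norm -exprM divnK; last first.
        by rewrite -(divnK d_dvd_m) mulnC expnM !subn1 (predn_exp (p ^ d)) dvdn_mulr.
      apply: (mulfI c_neq0); rewrite mulr1 -exprS subn1 prednK ?base_expr_card //.
      by rewrite expn_gt0 prime_gt0.
    (* Bezout gives u n = v (p^d - 1) + 1, so the two trivial powers force the norm itself to be
       1. *)
    have [u v bez _] := egcdnP (p ^ d - 1) n_gt0.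
    have := congr1 (fun e => N c%:A ^+ e) bez.
    rewrite (eqP coprime_n) mulnC exprM Nn1 expr1n addn1 exprS mulnC exprM Npd.
    by rewrite expr1n mulr1 => <-.
  split=> //; apply: bij_is_the_preimage => // w /preim[_ w_eq].
  rewrite (resolvent_full p_prime card_F dim_L m_gt0 r_gt0 d_def c_neq0 w_eq).
  have N_neq0 : N c%:A ^+ n != 0 by rewrite !expf_neq0.
  rewrite mulrA [X in X * w]mulrAC mulrBr mulr1 !divff ?mul1r //.
  by rewrite subr_eq0 eq_sym.
- apply: bij_is_the_preimage => // w /preim[Tw w_eq]; rewrite Tw.
  have n_neq0 : n%:R != 0 :> L by rewrite -(dvdn_pcharf p_char).
  have bE k : a^-1 *: (k%:R * x ^+ (p ^ (k * m * r %/ d)))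
      = k%:R * (a^-1 *: x) ^+ (p ^ (k * m * r %/ d)).
    rewrite exprZn -scalerAr; congr (_ *: (_ * _)).
    (* The exponents [k * m * r %/ d] are multiples of [m], so they fix [a^-1], which may therefore
       move inside the power. *)
    have aq : a^-1 ^+ (p ^ m) = a^-1 by rewrite -card_F expf_card.
    have d_dvd_r : (d %| r)%N by rewrite d_def dvdn_gcdr.
    rewrite -muln_divA // mulnAC -[(_ * m)%N]addn0.
    by rewrite expr_pow_period ?expr1.
  under eq_bigr => j _ do rewrite scaler_sumr (eq_bigr _ (fun k _ => bE k)).
  rewrite (resolvent_norm1 p_prime card_F dim_L m_gt0 n_gt0 r_gt0 d_def d_def' c_neq0 w_eq N1).
  by rewrite addrC subrK mulKf.
Qed.
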